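(* Let $n\ge 2$ and consider observations $y_t=\mu^0_t+\varepsilon_t$, $1\le t\le n$, where the mean vector $\mu^0=(\mu^0_1,\dots,\mu^0_n)'$ is a joint (continuous) piecewise linear trend: there are change (kink) points $1=t_0<t_1<\dots<t_J<t_{J+1}=n+1$ and pairs $(a_j,b_j)$ with $\mu^0_t=a_j+b_jt$ for $t_{j-1}\le t\le t_j-1$, $j=1,\dots,J+1$, and $a_{j-1}+b_{j-1}t_j=a_j+b_jt_j$ for $1\le j\le J$. Assume: (A1) the $\varepsilon_t$ are i.i.d. with mean $0$ and finite variance $\sigma^2$, and sub-Gaussian in the sense that $E[\exp(s\varepsilon_t)]\le\exp(\sigma^2s^2/2)$ for all real $s$; (A2) $\mu^0$ has at most $J_{\max}$ local linear pieces. For $\lambda>0$ let $\widehat\mu(\lambda)$ be the $\ell_1$ linear trend filter $$\widehat\mu(\lambda)=\arg\min_{\mu\in\mathbb R^n}\Big\{\tfrac12\sum_{t=1}^n(y_t-\mu_t)^2+\lambda\sum_{t=3}^n|\mu_t+\mu_{t-2}-2\mu_{t-1}|\Big\},$$ and let $\lambda_0>0$ be such that $\widehat\mu(\lambda)$ has at most $J_{\max}$ local linear pieces for every $\lambda>\lambda_0$. Let $$\lambda_n=16^{-1}\sigma A(BJ_{\max}\log n)^{1/2}n^{-1/2}-32^{-1/2}\sigma (J_{\max})^{1/2}n^{-1/2}$$ for some constants $0<A<1$ and $B>2(1-A)^{-2}$, and suppose $\lambda_n>\lambda_0$. Then for $\widehat\mu=\widehat\mu(\lambda_n)$, $$P\Big(n^{-1/2}\|\widehat\mu-\mu^0\|_2\ge\sigma(BJ_{\max}\log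 n/n)^{1/2}\Big)\le J_{\max}\,n^{[1-B(1-A)^2/2]J_{\max}}.$$
   Context: A ''local linear piece'' of a vector $\mu\in\mathbb R^n$ is a maximal block of consecutive indices on which $t\mapsto\mu_t$ is affine. $\|\cdot\|_2$ is the Euclidean norm.
   Formalization: The continuity condition is stated as a_j+b_j t_j = a_{j+1}+b_{j+1} t_j for 1≤j≤J, because the printed condition refers to an undefined pair (a_0,b_0) and does not match the indexing of the pieces; no mean vector is excluded by this. *)

(* Defs.v *)
From HB Require Import structures.
From mathcomp Require Import all_boot all_order all_algebra.
From mathcomp Require Import all_classical all_reals all_analysis.
Set Implicit Arguments. Unset Strict Implicit. Unset Printing Implicit Defensive.
Import Order.TTheory GRing.Theory Num.Theory.
Local Open Scope classical_set_scope.
Local Open Scope ring_scope.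

(* Vectors of R^n are represented as functions nat -> R, only the entries at
   indices t = 1, ..., n being relevant. *)

Section Defs.
Variable R : realType.

Definition affine_on (mu : nat -> R) (p q : nat) : Prop :=
  exists a b : R, forall t : nat, (p <= t <= q)%N -> mu t = a + b * t%:R.

Definition local_linear_piece (n : nat) (mu : nat -> R) (p q : nat) : Prop :=
  [/\ (1 <= p <= q)%N, (q <= n)%N, affine_on mu p q,
      ((1 < p)%N -> ~ affine_on mu p.-1 q)
    & ((q < n)%N -> ~ affine_on mu p q.+1)].

Definition num_pieces (n : nat) (mu : nat -> R) : nat :=
  #|[set pq : 'I_n.+1 * 'I_n.+1 |
       `[< local_linear_piece n mu pq.1 pq.2 >] ]|.

Definition tf_obj (n : nat) (y : nat -> R) (lam : R) (mu : nat -> R) : R :=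
  2^-1 * (\sum_(1 <= t < n.+1) (y t - mu t) ^+ 2)
  + lam * (\sum_(3 <= t < n.+1) `|mu t + mu (t - 2)%N - 2 * mu (t - 1)%N|).

(* mu is a (the, by strict convexity) minimizer of the objective over R^n *)
Definition tf_argmin (n : nat) (y : nat -> R) (lam : R) (mu : nat -> R) : Prop :=
  forall nu : nat -> R, tf_obj n y lam mu <= tf_obj n y lam nu.

Definition dist2 (n : nat) (x z : nat -> R) : R :=
  Num.sqrt (\sum_(1 <= t < n.+1) (x t - z t) ^+ 2).

End Defs.

Section Prob.
Context {d : measure_display} {T : measurableType d} {R : realType}.
Local Open Scope ereal_scope.

Definition mutually_independent (P : probability T R) (n : nat)
    (X : nat -> {RV P >-> R}) : Prop :=
  forall (S : seq nat) (B : nat -> set R),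
    uniq S -> all (fun i => (1 <= i <= n)%N) S ->
    (forall i, measurable (B i)) ->
    P [set w | forall i, i \in S -> B i (X i w)]
    = \prod_(i <- S) P (X i @^-1` B i).

Definition identically_distributed (P : probability T R) (n : nat)
    (X : nat -> {RV P >-> R}) : Prop :=
  forall i j, (1 <= i <= n)%N -> (1 <= j <= n)%N ->
    forall B : set R, measurable B -> P (X i @^-1` B) = P (X j @^-1` B).
End Prob.
Arguments mutually_independent {d T R} P n X.
Arguments identically_distributed {d T R} P n X.

(* Main.v *)
(** Let [K = Jmax], [x = sqrt (B K ln n)] and [dl = muhat - mu0]. First-order
optimality of [muhat] gives [|dl|^2 <= eps . dl + 4 lamn sqrt n |dl|]. A vector
with at most [K] local linear pieces has at most [K - 1] kinks, so [dl] lies in the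
span of [1], [t] and at most [2 (K - 1)] hinge functions [(t - s)_+]: the kinks of
[mu0] are fixed, those of [muhat] range over at most [n^(K-1)] choices. Hence on the
event [|dl| >= sigma x] one of [n^(K-1)] projections of [eps], each of rank at most
[2 K], has norm at least [sigma x (1 - A / 4)].

For a projection of rank [r] onto the span of an orthonormal family,
[E exp (kap |proj eps|^2) <= (1 - 2 kap sigma^2)^(-r/2)], because [exp (kap |z|^2)]
is a Gaussian average of exponentials of linear forms in [z]. With
[1 - 2 kap sigma^2 = A / 2], the condition [0 < lamn], that is [8 K < A^2 x^2],
absorbs the factor [(2 / A)^K], and each projection contributes at most
[exp (- (1 - A)^2 x^2 / 2)]; the union bound concludes. *)

Require Import Defs.
From HB Require Import structures.
From mathcomp Require Import all_boot all_order all_algebra.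
From mathcomp Require Import all_classical all_reals all_analysis.
From mathcomp Require Import measurable_realfun.
From mathcomp Require Import ring lra zify.
Import Order.TTheory GRing.Theory Num.Theory.
Set Implicit Arguments.
Unset Strict Implicit.
Unset Printing Implicit Defensive.
Local Open Scope classical_set_scope.
Local Open Scope ring_scope.

(** * Trend filtering inequalities *)

Section Euclid.
Variables (R : realType) (n : nat).
Implicit Types u v w : nat -> R.

Definition dot u v : R := \sum_(1 <= t < n.+1) u t * v t.
Definition enorm u : R := Num.sqrt (dot u u).

Lemma eq_dot u u' v v' : (forall t, (1 <= t <= n)%N -> u t = u' t) ->
  (forall t, (1 <= t <= n)%N -> v t = v' t) -> dot u v = dot u' v'.
Proof. by move=> uu' vv'; apply: eq_big_nat => t tn; rewrite uu' ?vv'. Qed.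

Lemma dotC u v : dot u v = dot v u.
Proof. by apply: eq_bigr => t _; rewrite mulrC. Qed.

Lemma dotDl u v w : dot (fun t => u t + v t) w = dot u w + dot v w.
Proof. by rewrite -big_split; apply: eq_bigr => t _; rewrite mulrDl. Qed.

Lemma dotZl a u v : dot (fun t => a * u t) v = a * dot u v.
Proof. by rewrite mulr_sumr; apply: eq_bigr => t _; rewrite mulrA. Qed.

Lemma dotBl u v w : dot (fun t => u t - v t) w = dot u w - dot v w.
Proof. by rewrite -sumrB; apply: eq_bigr => t _; rewrite mulrBl. Qed.

Lemma dotDr u v w : dot w (fun t => u t + v t) = dot w u + dot w v.
Proof. by rewrite dotC dotDl !(dotC w). Qed.

Lemma dotZr a u v : dot u (fun t => a * v t) = a * dot u v.
Proof. by rewrite dotC dotZl dotC. Qed.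

Lemma dotBr u v w : dot w (fun t => u t - v t) = dot w u - dot w v.
Proof. by rewrite dotC dotBl !(dotC w). Qed.

Lemma dotvv_subZ u v h : dot (fun t => u t - h * v t) (fun t => u t - h * v t) =
  dot u u - 2 * h * dot u v + h ^+ 2 * dot v v.
Proof. by rewrite dotBl !dotBr !dotZl !dotZr (dotC v u); ring. Qed.

Lemma dot_suml (I : Type) (r : seq I) (Q : pred I) (F : I -> nat -> R) v :
  dot (fun t => \sum_(i <- r | Q i) F i t) v = \sum_(i <- r | Q i) dot (F i) v.
Proof.
by rewrite exchange_big; apply: eq_bigr => t _; rewrite mulr_suml.
Qed.

Lemma dotvv_ge0 u : 0 <= dot u u.
Proof. by apply: sumr_ge0 => t _; rewrite -expr2 sqr_ge0. Qed.

Lemma dotvv_eq0 u t : dot u u = 0 -> (1 <= t <= n)%N -> u t = 0.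
Proof.
move=> /eqP; rewrite psumr_eq0; last by move=> i _; rewrite -expr2 sqr_ge0.
move=> /allP/(_ t) u0 tn; apply/eqP; rewrite -sqrf_eq0 expr2.
by apply: u0; rewrite mem_index_iota.
Qed.

Lemma enorm_ge0 u : 0 <= enorm u. Proof. exact: sqrtr_ge0. Qed.

Lemma sqr_enorm u : enorm u ^+ 2 = dot u u.
Proof. by rewrite sqr_sqrtr// dotvv_ge0. Qed.

Lemma dot_le_enorm u v : dot u v <= enorm u * enorm v.
Proof.
have [v0|v0] := eqVneq (dot v v) 0.
  rewrite /dot big_nat big1 ?mulr_ge0 ?enorm_ge0// => t tn.
  by rewrite (dotvv_eq0 v0)// mulr0.
have vp : 0 < dot v v by rewrite lt_neqAle eq_sym v0 dotvv_ge0.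
have := dotvv_ge0 (fun t => dot v v * u t - dot u v * v t).
rewrite dotBl !dotBr !dotZl !dotZr (dotC v u) => H.
have {}H : dot u v ^+ 2 <= dot u u * dot v v.
  rewrite -(ler_pM2l vp) -subr_ge0; apply: le_trans H _.
  by rewrite le_eqVlt; apply/orP; left; apply/eqP; ring.
apply: le_trans (ler_norm _) _.
rewrite -ler_sqr ?nnegrE ?mulr_ge0 ?enorm_ge0//.
by rewrite exprMn !sqr_enorm real_normK ?num_real.
Qed.

Lemma enormD u v : enorm (fun t => u t + v t) <= enorm u + enorm v.
Proof.
rewrite -ler_sqr ?nnegrE ?addr_ge0 ?enorm_ge0//.
rewrite sqr_enorm sqrrD !sqr_enorm dotDl !dotDr (dotC v u).
have := dot_le_enorm u v; lra.
Qed.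

Lemma dist2E u v : dist2 n u v = enorm (fun t => u t - v t).
Proof. by congr Num.sqrt; apply: eq_bigr => t _; rewrite expr2. Qed.

Lemma enorm_le_sup u e : 0 <= e -> (forall t, (1 <= t <= n)%N -> `|u t| <= e) ->
  enorm u <= Num.sqrt n%:R * e.
Proof.
move=> e0 ue; rewrite -ler_sqr ?nnegrE ?mulr_ge0 ?sqrtr_ge0 ?enorm_ge0//.
rewrite sqr_enorm exprMn sqr_sqrtr// /dot.
apply: (@le_trans _ _ (\sum_(1 <= t < n.+1) e ^+ 2)).
  rewrite big_nat [leRHS]big_nat; apply: ler_sum => t tn.
  by rewrite -expr2 -real_normK ?num_real// lerXn2r ?nnegrE// ue.
by rewrite sumr_const_nat subn1 mulr_natl.
Qed.

Lemma sum_norm_le_enorm u :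
  \sum_(1 <= t < n.+1) `|u t| <= Num.sqrt n%:R * enorm u.
Proof.
pose v t := `|u t|.
have -> : \sum_(1 <= t < n.+1) `|u t| = dot (fun=> 1) v.
  by apply: eq_bigr => t _; rewrite mul1r.
apply: le_trans (dot_le_enorm _ _) _.
rewrite le_eqVlt; apply/orP; left; apply/eqP; congr (_ * _).
  by congr Num.sqrt; rewrite /dot sumr_const_nat subn1 mulr1.
congr Num.sqrt; apply: eq_bigr => t _.
by rewrite -expr2 real_normK ?num_real// expr2.
Qed.

End Euclid.

(** * First-order optimality of the trend filter and its consequences *)

Section TrendFilter.
Variables (R : realType) (n : nat).
Implicit Types mu nu y : nat -> R.

Definition diff2 mu t : R := mu t + mu (t - 2)%N - 2 * mu (t - 1)%N.
Definition tv2 mu : R := \sum_(3 <= t < n.+1) `|diff2 mu t|.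

Lemma tf_objE y lam mu : tf_obj n y lam mu =
  2^-1 * dot n (fun t => y t - mu t) (fun t => y t - mu t) + lam * tv2 mu.
Proof.
by congr (_ * _ + _); apply: eq_bigr => t _; rewrite expr2.
Qed.

Lemma tv2_conv mu nu h : 0 <= h <= 1 ->
  tv2 (fun t => mu t + h * (nu t - mu t)) <= (1 - h) * tv2 mu + h * tv2 nu.
Proof.
move=> /andP[h0 h1]; rewrite /tv2 !mulr_sumr -big_split/=.
apply: ler_sum => t _.
have -> : diff2 (fun t => mu t + h * (nu t - mu t)) t =
  (1 - h) * diff2 mu t + h * diff2 nu t by rewrite /diff2; ring.
apply: le_trans (ler_normD _ _) _.
by rewrite !normrM ger0_norm ?subr_ge0// (ger0_norm h0).
Qed.

Lemma le0_of_le_linear (X N : R) : 0 <= N ->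
  (forall h, 0 < h <= 1 -> X <= h * N) -> X <= 0.
Proof.
move=> N0 H; rewrite leNgt; apply/negP => X0.
have D : 0 < X + N + 1 by lra.
(* If [X] were positive, this [h] would lie in (0, 1] and give [h * N < X], because
   [N < X + N + 1]. *)
have := H (X / (X + N + 1)); rewrite divr_gt0//= ler_pdivrMr// mul1r.
rewrite -addrA lerDl addr_ge0// => /(_ isT).
rewrite mulrAC ler_pdivlMr ?addrA// ler_pM2l//; lra.
Qed.

(** Compare [mu] with [mu + h (nu - mu)]: convexity makes the penalty change at most linear in [h],
    the quadratic remainder is of order [h ^+ 2], and dividing by [h] and letting it tend to 0
    leaves the first-order terms. No derivative of the absolute values is taken. *)
Lemma tf_argmin_variational y lam mu nu : 0 <= lam -> tf_argmin n y lam mu ->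
  dot n (fun t => y t - mu t) (fun t => nu t - mu t) <= lam * (tv2 nu - tv2 mu).
Proof.
move=> lam0 mumin; rewrite -subr_le0.
set p := fun t => y t - mu t; set q := fun t => nu t - mu t.
apply: (@le0_of_le_linear _ (dot n q q)); first exact: dotvv_ge0.
move=> h /andP[h0 h1]; rewrite -(ler_pM2l h0).
have := mumin (fun t => mu t + h * q t); rewrite !tf_objE.
have -> : dot n (fun t => y t - (mu t + h * q t)) (fun t => y t - (mu t + h * q t))
  = dot n p p - 2 * h * dot n p q + h ^+ 2 * dot n q q.
  rewrite (@eq_dot _ _ _ (fun t => p t - h * q t) _ (fun t => p t - h * q t));
    try by move=> t _; rewrite /p; ring.
  exact: dotvv_subZ.
have := @tv2_conv mu nu h; rewrite h1 ltW// => /(_ isT).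
move=> /(ler_wpM2l lam0); have := dotvv_ge0 n q.
rewrite -/p -/q => q0 H1 H2; have := mulr_ge0 (sqr_ge0 h) q0.
move: H1 H2; rewrite -[X in lam * X <= _]/(tv2 (fun t => mu t + h * q t)); lra.
Qed.

(** Testing each minimizer against the other and adding makes the penalties cancel, which leaves
    [dot n m m <= dot n e m]; Cauchy-Schwarz concludes. This continuity in the data later yields
    measurability of the deviation event. *)
Lemma tf_argmin_lipschitz y1 y2 lam mu1 mu2 : 0 <= lam ->
  tf_argmin n y1 lam mu1 -> tf_argmin n y2 lam mu2 ->
  enorm n (fun t => mu2 t - mu1 t) <= enorm n (fun t => y2 t - y1 t).
Proof.
move=> lam0 /(@tf_argmin_variational _ _ _ mu2 lam0) H1.
move=> /(@tf_argmin_variational _ _ _ mu1 lam0) H2.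
set m := fun t => mu2 t - mu1 t; set e := fun t => y2 t - y1 t.
have : dot n m m <= dot n e m.
  have := lerD H1 H2; rewrite -subr_ge0 -[in X in _ -> X]subr_ge0 => H.
  apply: le_trans H _; rewrite /m /e !dotBl !dotBr.
  by rewrite (dotC n mu1 mu2); lra.
rewrite -sqr_enorm => /le_trans/(_ (dot_le_enorm _ _ _)).
have [->|m0] := eqVneq (enorm n m) 0; first by rewrite enorm_ge0.
by rewrite expr2 ler_pM2r// lt_neqAle eq_sym m0 enorm_ge0.
Qed.

Lemma tv2_triangle mu nu : tv2 mu - tv2 nu <= tv2 (fun t => nu t - mu t).
Proof.
rewrite /tv2 -sumrB; apply: ler_sum => t _; rewrite lerBlDr.
have -> : diff2 mu t = - diff2 (fun t => nu t - mu t) t + diff2 nu t.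
  by rewrite /diff2; ring.
by apply: le_trans (ler_normD _ _) _; rewrite normrN.
Qed.

Lemma ler_sum_nat_subrange (F : nat -> R) p q m k : (forall i, 0 <= F i) ->
  (p <= m)%N -> (k <= q)%N ->
  \sum_(m <= i < k) F i <= \sum_(p <= i < q) F i.
Proof.
move=> F0 pm kq; have [mk|mk] := leqP k m.
  by rewrite big_geq// sumr_ge0.
rewrite (big_cat_nat pm (leq_trans (ltnW mk) kq))/=.
rewrite (big_cat_nat (ltnW mk) kq)/= addrCA lerDl.
by rewrite addr_ge0// sumr_ge0.
Qed.

(** Each entry enters at most three second differences, with weights 1, 2 and 1. *)
Lemma tv2_le_sum mu : tv2 mu <= 4 * \sum_(1 <= t < n.+1) `|mu t|.
Proof.
have shift k : (k <= 2)%N ->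
    \sum_(3 <= t < n.+1) `|mu (t - k)%N| <= \sum_(1 <= t < n.+1) `|mu t|.
  move=> k2; have -> : 3%N = (3 - k + k)%N by rewrite subnK// ltnW.
  rewrite big_addn; under eq_bigr do rewrite addnK.
  by apply: ler_sum_nat_subrange => //; rewrite ?leq_subr// subn_gt0.
have S0 := shift 0%N isT; have S1 := shift 1%N isT; have S2 := shift 2%N isT.
apply: (@le_trans _ _ (\sum_(3 <= t < n.+1) (`|mu (t - 0)%N| + `|mu (t - 2)%N| +
    2 * `|mu (t - 1)%N|))).
  apply: ler_sum => t _; rewrite /diff2 subn0.
  apply: le_trans (ler_normB _ _) _; rewrite normrM ger0_norm// lerD2r.
  exact: ler_normD.
rewrite !big_split/= -mulr_sumr; lra.
Qed.

(** The variational inequality is tested at [mu0]; the penalty difference is at most [tv2] of the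
    error, hence at most 4 times its l1 norm, hence at most [4 * Num.sqrt n%:R] times its Euclidean
    norm. *)
Lemma tf_basic_inequality y lam mu mu0 (dl := fun t => mu t - mu0 t) :
  0 <= lam -> tf_argmin n y lam mu ->
  enorm n dl ^+ 2 <=
    dot n (fun t => y t - mu0 t) dl + 4 * lam * Num.sqrt n%:R * enorm n dl.
Proof.
move=> lam0 /(@tf_argmin_variational _ _ _ mu0 lam0).
have : lam * (tv2 mu0 - tv2 mu) <= 4 * lam * Num.sqrt n%:R * enorm n dl.
  rewrite -!mulrA [leRHS]mulrCA; apply: ler_wpM2l => //.
  apply: le_trans (tv2_triangle _ _) _; apply: le_trans (tv2_le_sum _) _.
  by apply: ler_wpM2l => //; exact: sum_norm_le_enorm.
move=> + H => /(le_trans H); rewrite sqr_enorm /dl !dotBl !dotBr.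
by rewrite (dotC n mu0 mu); lra.
Qed.

End TrendFilter.

(** * Orthonormal families and kinks *)

Section Orthonormal.
Variables (R : realType) (n : nat).
Implicit Types (u v e : nat -> R) (es vs : seq (nat -> R)).

Definition orthogonal_to u es := forall e, e \in es -> dot n u e = 0.

Fixpoint orthonormal_seq es : Prop :=
  if es is e :: es' then [/\ dot n e e = 1, orthogonal_to e es' & orthonormal_seq es']
  else True.

Definition proj es v t : R := \sum_(e <- es) dot n v e * e t.

(** For orthonormal [es] this is membership in the span, as seen on the indices 1 to [n]. Stated as
    an equation, it is closed under linear combinations without naming coefficients. *)
Definition fixed_by es v := forall t, (1 <= t <= n)%N -> v t = proj es v t.

Lemma sum_dot_orthonormal es (F : (nat -> R) -> R) e : orthonormal_seq es ->
  e \in es -> \sum_(e' <- es) F e' * dot n e' e = F e.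
Proof.
elim: es => // e1 es ih /= [e11 e1es oes]; rewrite inE big_cons.
case/orP => [/eqP ->|ees]; last by rewrite ih// e1es// mulr0 add0r.
rewrite e11 mulr1 big_seq big1 ?addr0// => e' e'es.
by rewrite dotC e1es ?mulr0.
Qed.

Lemma dot_proj es v e : orthonormal_seq es -> e \in es ->
  dot n (proj es v) e = dot n v e.
Proof.
move=> oes ees; rewrite /proj dot_suml.
under eq_bigr do rewrite dotZl.
by rewrite (sum_dot_orthonormal (fun e => dot n v e)).
Qed.

Lemma fixed_byD es u v : fixed_by es u -> fixed_by es v ->
  fixed_by es (fun t => u t + v t).
Proof.
move=> fu fv t tn; rewrite fu// fv// -big_split/=; apply: eq_bigr => e _.
by rewrite dotDl mulrDl.
Qed.

Lemma fixed_byZ es a v : fixed_by es v -> fixed_by es (fun t => a * v t).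
Proof.
move=> fv t tn; rewrite fv// mulr_sumr; apply: eq_bigr => e _.
by rewrite dotZl mulrA.
Qed.

Lemma fixed_by_sum es (I : Type) (r : seq I) (Q : pred I) (F : I -> nat -> R) :
  (forall i, Q i -> fixed_by es (F i)) ->
  fixed_by es (fun t => \sum_(i <- r | Q i) F i t).
Proof.
move=> fF t tn; rewrite /proj; under [RHS]eq_bigr do rewrite dot_suml mulr_suml.
by rewrite exchange_big/=; apply: eq_bigr => i Qi; rewrite fF.
Qed.

Lemma eq_fixed_by es u v : (forall t, (1 <= t <= n)%N -> u t = v t) ->
  fixed_by es u -> fixed_by es v.
Proof.
move=> uv fu t tn; rewrite -uv// fu//; apply: eq_bigr => e _; congr (_ * _).
exact: eq_dot.
Qed.

Lemma fixed_by_cons es e v : orthogonal_to e es -> fixed_by es v ->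
  fixed_by (e :: es) v.
Proof.
move=> ees fv t tn; rewrite /proj big_cons.
rewrite (@eq_dot _ _ v (proj es v) e e)// /proj dot_suml.
rewrite big_seq big1 ?mul0r ?add0r; first exact: fv.
by move=> e' e'es; rewrite dotZl (dotC n e') ees ?mulr0.
Qed.

(** A vector whose residual vanishes is already in the span and adds nothing, so [vs] may be
    dependent and only an upper bound on the size holds. *)
Lemma gram_schmidt vs : exists es, [/\ (size es <= size vs)%N, orthonormal_seq es
  & forall v, v \in vs -> fixed_by es v].
Proof.
elim: vs => [|v vs [es [ses oes fes]]]; first by exists [::].
pose r t := v t - proj es v t.
have res : orthogonal_to r es by move=> e ees; rewrite dotBl dot_proj// subrr.
have [r0|r0] := eqVneq (dot n r r) 0.
  exists es; split => //; first exact: leqW.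
  move=> w; rewrite inE => /orP[/eqP ->|]; last exact: fes.
  by move=> t tn; apply/eqP; rewrite -subr_eq0; apply/eqP/(dotvv_eq0 r0).
have rp : 0 < enorm n r.
  by rewrite sqrtr_gt0 lt_neqAle eq_sym r0 dotvv_ge0.
pose e t := (enorm n r)^-1 * r t.
have ees : orthogonal_to e es by move=> e' e'es; rewrite dotZl res// mulr0.
exists (e :: es); split => //=.
- split => //; rewrite dotZl dotZr -sqr_enorm.
  by field; rewrite gt_eqF.
- move=> w; rewrite inE => /orP[/eqP ->|]; last first.
    by move=> /fes; exact: fixed_by_cons.
  move=> t tn; rewrite /proj big_cons -/(proj es v t).
  have -> : dot n v e = enorm n r.
    rewrite (@eq_dot _ _ v (fun t => r t + proj es v t) e e)//; last first.
      by move=> i _; rewrite subrK.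
    rewrite dotDl [X in _ + X]dot_suml big_seq big1 ?addr0.
      by rewrite dotZr -sqr_enorm expr2 mulKf// gt_eqF.
    by move=> e' e'es; rewrite dotZl (dotC n e') ees// mulr0.
  by rewrite /e mulVKf ?gt_eqF// subrK.
Qed.

(** Against a vector of the span, [u] may be replaced by its projection; Cauchy-Schwarz then
    applies, and the norm of the projection is given by Parseval. *)
Lemma dot_fixed_le es u v : orthonormal_seq es -> fixed_by es v ->
  dot n u v <= enorm n v * Num.sqrt (\sum_(e <- es) dot n e u ^+ 2).
Proof.
move=> oes fv.
have -> : dot n u v = dot n v (proj es u).
  rewrite dotC (@eq_dot _ _ v (proj es v) u u)// /proj dot_suml dotC dot_suml.
  by apply: eq_bigr => e _; rewrite !dotZl mulrC (dotC n e u) (dotC n v e) mulrC.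
apply: le_trans (dot_le_enorm _ _ _) _; apply: ler_wpM2l; first exact: enorm_ge0.
rewrite le_eqVlt; apply/orP; left; apply/eqP; congr Num.sqrt.
rewrite {1}/proj dot_suml !big_seq; apply: eq_bigr => e ees.
by rewrite dotZl (dotC n e) dot_proj// (dotC n u e) expr2.
Qed.

End Orthonormal.

(** * Kinks, local linear pieces and the hinge basis *)

Section Kinks.
Variables (R : realType) (n : nat).
Implicit Types mu : nat -> R.

(* [diff2 mu s.+1] is the second difference centred at [s]. *)
Definition kink mu s := (1 < s)%N && (diff2 mu s.+1 != 0).

Definition kinks mu : {set 'I_n} := [set s : 'I_n | kink mu s].

Lemma affine_on_pair mu q : affine_on mu q q.+1.
Proof.
exists (mu q - (mu q.+1 - mu q) * q%:R), (mu q.+1 - mu q) => t.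
have [->|tq] := eqVneq t q; first by move=> _; ring.
rewrite leq_eqVlt eq_sym (negbTE tq)/= => tq1.
have -> : t = q.+1 by apply/eqP; rewrite eqn_leq andbC.
by rewrite -natr1; ring.
Qed.

Lemma affine_on_diff2 mu p s : (1 < s)%N -> (p < s)%N -> affine_on mu p s.+1 ->
  diff2 mu s.+1 = 0.
Proof.
move=> s1 ps [a [b ab]]; rewrite /diff2.
case: s s1 ps ab => // s s1 ps ab; rewrite !subSS !subn0.
rewrite !ab; first by rewrite -!natr1; ring.
all: by lia.
Qed.

(* Every kink, and [n] itself, is the right end of some local linear piece. *)
Lemma card_kinks mu : (1 < n)%N -> (#|kinks mu| < num_pieces n mu)%N.
Proof.
move=> n1.
(* The witness [q.+1] gives an empty range; [ex_minn] then picks the leftmost start of an affine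
   block ending at [q]. *)
have start q : exists p, (1 <= p)%N && `[< affine_on mu p q >].
  exists q.+1; rewrite /=; apply/asboolP; exists 0, 0 => t /andP[qt tq].
  by have := leq_trans qt tq; rewrite ltnn.
pose p q := ex_minn (start q).
(* Adding the right end [n] to the kinks is what makes the inequality strict. *)
pose Q : {set 'I_n.+1} := (ord_max |: (widen_ord (leqnSn n) @: kinks mu))%SET.
have cardQ : #|Q| = #|kinks mu|.+1.
  rewrite cardsU1 card_imset; last first.
    by move=> i j /(congr1 val)/= ij; exact: val_inj.
  suff -> : ord_max \notin (widen_ord (leqnSn n) @: kinks mu) by [].
  apply/imsetP => -[s _ /(congr1 val)/= ns].
  by have := ltn_ord s; rewrite -ns ltnn.
have QP (q : 'I_n.+1) : q \in Q -> (1 < q <= n)%N /\ ((q < n)%N -> kink mu q).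
  rewrite !inE => /orP[/eqP ->/=|]; first by rewrite n1 leqnn ltnn.
  case/imsetP => s; rewrite inE => ks -> /=; split => //.
  by case/andP: ks => -> _; exact: ltnW.
(* Two consecutive points are always affine, so the block ending at [q] contains [q.-1]. Extending
   it to [q.+1] would then cover all three points of the second difference centred at [q]. *)
have pQ (q : 'I_n.+1) : q \in Q -> (1 <= p q < q)%N.
  move=> /QP[/andP[q1 qn] _]; rewrite /p; case: ex_minnP => m /andP[m0 _] mmin.
  have qE : (q : nat) = q.-1.+1 by lia.
  have aq : affine_on mu q.-1 q by rewrite {2}qE; exact: affine_on_pair.
  have mq : (m <= q.-1)%N by apply: mmin; rewrite asboolT// andbT; lia.
  by lia.
rewrite -cardQ /num_pieces.
rewrite -(@card_in_imset _ _ (fun q : 'I_n.+1 => (inord (p q) : 'I_n.+1, q))); last first.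
  by move=> i j _ _ [].
apply/subset_leq_card/fintype.subsetP => _ /imsetP[q qQ ->].
rewrite unfold_in/=.
have /andP[p1 pq] := pQ q qQ; have [/andP[q1 qn] kq] := QP q qQ.
apply/asboolP; rewrite /= inordK ?(ltn_trans pq)//.
apply/asboolP; split => //.
- by rewrite p1 ltnW.
- by rewrite /p; case: ex_minnP => m /andP[_ /asboolP].
- rewrite /p; case: ex_minnP => m _ mmin m1 am.
  have : (m <= m.-1)%N by apply: mmin; rewrite asboolT// andbT; lia.
  by lia.
- by move=> /kq /andP[_ /eqP kq'] /(affine_on_diff2 q1 pq).
Qed.

(* Truncated subtraction makes this the hinge function [t |-> (t - s)_+]. *)
Definition trunc_line s t : R := (t - s)%:R.

Lemma slope_diff2 mu k :
  mu k.+2 - mu k.+1 = mu 2 - mu 1 + \sum_(2 <= s < k.+2) diff2 mu s.+1.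
Proof.
elim: k => [|k ih]; first by rewrite big_geq// addr0.
rewrite big_nat_recr//= addrA -ih /diff2 !subSS !subn0; ring.
Qed.

(** A discrete Taylor formula: second differences are summed once into slopes and once more into
    values, and indices that are not kinks contribute 0. *)
Lemma truncated_power_rep mu t : (1 <= t <= n)%N ->
  mu t = mu 1 + (mu 2 - mu 1) * (t%:R - 1) +
         \sum_(s in kinks mu) diff2 mu s.+1 * trunc_line s t.
Proof.
case: t => // t /= tn.
have -> : \sum_(s in kinks mu) diff2 mu s.+1 * trunc_line s t.+1 =
    \sum_(2 <= s < t.+1) diff2 mu s.+1 * (t.+1 - s)%:R.
  transitivity (\sum_(0 <= s < n | (1 < s)%N) diff2 mu s.+1 * trunc_line s t.+1).
    rewrite big_mkord big_mkcond [RHS]big_mkcond; apply: eq_bigr => s _.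
    rewrite inE /kink; case: (1 < s)%N => //=.
    by case: eqP => //= ->; rewrite mul0r.
  rewrite [RHS](big_nat_widenl _ 0)// [RHS](big_nat_widen _ _ _ _ _ tn).
  rewrite [LHS]big_mkcond [RHS]big_mkcond/=; apply: eq_bigr => s _ /=.
  case: (1 < s)%N => //=; case: ltnP => // ts.
  by rewrite /trunc_line (eqP ts) mulr0.
elim: t tn => [|t ih] tn; first by rewrite big_geq// subrr mulr0 !addr0.
(* Moving from [t.+1] to [t.+2] raises every hinge with [s < t.+2] by 1; the new index [s = t.+1]
   has value 0 at the earlier point. *)
have step : \sum_(2 <= s < t.+2) diff2 mu s.+1 * (t.+2 - s)%:R =
    \sum_(2 <= s < t.+2) diff2 mu s.+1 +
    \sum_(2 <= s < t.+1) diff2 mu s.+1 * (t.+1 - s)%:R.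
  transitivity (\sum_(2 <= s < t.+2) (diff2 mu s.+1 + diff2 mu s.+1 * (t.+1 - s)%:R)).
    rewrite big_nat [RHS]big_nat; apply: eq_bigr => s /andP[_ st].
    by rewrite subSn// -natr1; ring.
  rewrite big_split; congr (_ + _); case: (t) => [|k]; first by rewrite !big_geq.
  by rewrite big_nat_recr//= subnn mulr0 addr0.
have := slope_diff2 mu t => /eqP; rewrite subr_eq => /eqP ->.
by rewrite (ih (ltnW tn)) step -[t.+2%:R]natr1; ring.
Qed.

End Kinks.
(** * Independence and sub-Gaussian quadratic forms *)

Section Independence.
Context d (T : measurableType d) (R : realType) (P : probability T R).

Import HBNNSimple.

Lemma nnsfun_range_ge0 (h : {nnsfun R >-> R}) y :
  y \in finmap.enum_fset (fset_set (range h)) -> 0 <= y.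
Proof. by rewrite (in_fset_set (fimfunP h)) inE => -[x _ <-]; exact: fun_ge0. Qed.

Lemma integral_mul_nnsfun (Z X : T -> R) (h : {nnsfun R >-> R}) :
  measurable_fun setT Z -> (forall w, 0 <= Z w) -> measurable_fun setT X ->
  (\int[P]_w (Z w * h (X w))%:E = \sum_(y <- finmap.enum_fset (fset_set (range h)))
    y%:E * \int[P]_w (Z w * \1_(h @^-1` [set y]) (X w))%:E)%E.
Proof.
move=> mZ Z0 mX; set s := finmap.enum_fset _.
have m1 y : measurable_fun setT (fun w => Z w * \1_(h @^-1` [set y]) (X w)).
  by apply: measurable_funM => //; apply: measurableT_comp => //; exact: measurable_indic.
transitivity (\int[P]_w (\sum_(y <- s) (y%:E *
    (Z w * \1_(h @^-1` [set y]) (X w))%:E)))%E.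
  apply: eq_integral => w _; rewrite fimfunE fsbig_finite//= mulr_sumr -sumEFin.
  by apply: eq_bigr => i _; rewrite -EFinM mulrCA.
rewrite ge0_integral_sum//.
- rewrite !big_seq; apply: eq_bigr => y ys; rewrite ge0_integralZl//=.
  + by apply/measurable_EFinP; exact: m1.
  + by move=> w _; rewrite lee_fin mulr_ge0.
  + by rewrite lee_fin (nnsfun_range_ge0 ys).
- by move=> y; apply: measurable_funeM; apply/measurable_EFinP; exact: m1.
- move=> y w _; rewrite -EFinM lee_fin mulrCA mulr_ge0// indicE.
  case: (boolP (_ \in _)) => [|_]; last by rewrite mulr0.
  by rewrite inE/= => <-; rewrite mulr1 fun_ge0.
Qed.

(** A factorization known for indicators passes to simple functions by linearity and to nonnegative
    [f] by monotone convergence. [C] is real so that multiplication by it commutes with the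
    limit. *)
Lemma integral_mul_of_law (Z X : T -> R) (C : R) (f : R -> R) :
  measurable_fun setT Z -> (forall w, 0 <= Z w) -> measurable_fun setT X ->
  measurable_fun setT f -> (forall x, 0 <= f x) ->
  (forall B, measurable B ->
    \int[P]_w (Z w * \1_B (X w))%:E = C%:E * P (X @^-1` B))%E ->
  (\int[P]_w (Z w * f (X w))%:E = C%:E * \int[P]_w (f (X w))%:E)%E.
Proof.
move=> mZ Z0 mX mf f0 law.
have mEf : measurable_fun setT (EFin \o f) by exact/measurable_EFinP.
pose h := nnsfun_approx measurableT mEf.
have Ef0 x : setT x -> (0 <= (EFin \o f) x)%E by move=> _; rewrite lee_fin.
have mct (Y : T -> R) : measurable_fun setT Y -> (forall w, 0 <= Y w) ->
    (\int[P]_w (Y w * h k (X w))%:E)%E @[k --> \oo] -->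
    (\int[P]_w (Y w * f (X w))%:E)%E.
  move=> mY Y0.
  have mg k : measurable_fun setT (fun w => (Y w * h k (X w))%:E).
    by apply/measurable_EFinP; apply: measurable_funM => //; exact: measurableT_comp.
  have -> : (\int[P]_w (Y w * f (X w))%:E = \int[P]_w
      limn (fun k => (Y w * h k (X w))%:E))%E.
    apply: eq_integral => w _; apply/esym/cvg_lim => //; rewrite EFinM.
    under eq_fun do rewrite EFinM; apply: cvgeZl => //.
    exact: (cvg_nnsfun_approx measurableT mEf Ef0 Logic.I).
  apply: cvg_monotone_convergence => //.
  - by move=> k w _; rewrite lee_fin mulr_ge0.
  - move=> w _ j k jk; rewrite lee_fin ler_wpM2l//.
    exact/lefP/nd_nnsfun_approx.
have := mct Z mZ Z0.
have : (C%:E * \int[P]_w (1 * h k (X w))%:E)%E @[k --> \oo] -->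
    (C%:E * \int[P]_w (1 * f (X w))%:E)%E.
  by apply: cvgeZl => //; exact: (mct (fun=> 1)).
have -> : (\int[P]_w (f (X w))%:E = \int[P]_w (1 * f (X w))%:E)%E.
  by apply: eq_integral => w _; rewrite mul1r.
have -> : (fun k => C%:E * \int[P]_w (1 * h k (X w))%:E)%E =
    (fun k => \int[P]_w (Z w * h k (X w))%:E)%E; last first.
  by move=> /cvg_lim <-// /cvg_lim <-.
apply/funext => k; rewrite !integral_mul_nnsfun// !big_seq ge0_sume_distrr//.
  apply: eq_bigr => y _; rewrite law// muleCA; congr (_ * (_ * _))%E.
  transitivity (\int[P]_w (\1_(X @^-1` (h k @^-1` [set y])) w)%:E)%E.
    by apply: eq_integral => w _; rewrite mul1r.
  rewrite integral_indic ?setIT// -[X @^-1` _]setTI; exact: mX.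
move=> y ys; apply: mule_ge0; first by rewrite lee_fin (nnsfun_range_ge0 ys).
by apply: integral_ge0 => w _; rewrite lee_fin mul1r.
Qed.

Lemma measurable_indic_comp (X : T -> R) (B : set R) : measurable_fun setT X ->
  measurable B -> measurable_fun setT (fun w => \1_B (X w) : R).
Proof.
move=> mX mB.
exact: (measurableT_comp (@measurable_indic _ _ R setT B mB) mX).
Qed.

Lemma prod_indicE (I : eqType) (S : seq I) (B : I -> set R) (x : I -> R) :
  \prod_(i <- S) \1_(B i) (x i) = (all (fun i => x i \in B i) S)%:R :> R.
Proof.
elim: S => [|i S ih]; first by rewrite big_nil.
by rewrite big_cons ih indicE -natrM mulnb.
Qed.

(** Indicators are traded for functions one index at a time. With [S1] empty this is the definition
    of independence; the inductive step moves [i] into [S2] as an indicator, and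
    [integral_mul_of_law] upgrades that indicator to [f i]. *)
Lemma integral_prod_independent n (X : nat -> {RV P >-> R}) (f : nat -> R -> R)
    (S1 S2 : seq nat) (B : nat -> set R) :
  mutually_independent P n X ->
  (forall i, measurable_fun setT (f i)) -> (forall i x, 0 <= f i x) ->
  (forall i, i \in S1 -> (\int[P]_w (f i (X i w))%:E)%E \is a fin_num) ->
  uniq (S1 ++ S2) -> all (fun i => (1 <= i <= n)%N) (S1 ++ S2) ->
  (forall i, measurable (B i)) ->
  (\int[P]_w ((\prod_(i <- S1) f i (X i w)) * \prod_(i <- S2) \1_(B i) (X i w))%:E =
   (\prod_(i <- S1) \int[P]_w (f i (X i w))%:E) *
   \prod_(i <- S2) P (X i @^-1` B i))%E.
Proof.
move=> indep mf f0; elim: S1 S2 B => [|i S1 ih] S2 B finf /= uS aS mB.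
  rewrite big_nil mul1e -indep//.
  set A := [set w | _].
  have gA w : \prod_(i <- S2) \1_(B i) (X i w) = \1_A w :> R.
    rewrite (prod_indicE S2 B (fun i => X i w)) indicE; congr (nat_of_bool _)%:R.
    apply/allP/idP => [H|]; first by rewrite inE => i /H; rewrite inE.
    by rewrite inE => H i /H; rewrite inE.
  have mg : measurable_fun setT (\1_A : T -> R).
    rewrite -(_ : (fun w => \prod_(i <- S2) \1_(B i) (X i w)) = \1_A); last first.
      exact/funext.
    apply: measurable_prod => i _.
    exact: measurable_indic_comp.
  have mA : measurable A.
    rewrite (_ : A = setT `&` (\1_A : T -> R) @^-1` [set 1]).
      exact: mg.
    rewrite setTI; apply/seteqP; split => w /=; rewrite indicE.
      by move=> Aw; rewrite mem_set.
    by case: (boolP (w \in A)) => [/set_mem|_ /esym/eqP]//; rewrite oner_eq0.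
  rewrite -[in RHS](setIT A) -(integral_indic P measurableT)//.
  by apply: eq_integral => w _; rewrite big_nil mul1r gA.
move: uS aS => /andP[iS uS] /andP[i1n aS].
pose Z w := (\prod_(i <- S1) f i (X i w)) * \prod_(i <- S2) \1_(B i) (X i w).
pose C := ((\prod_(i <- S1) \int[P]_w (f i (X i w))%:E) *
   \prod_(i <- S2) P (X i @^-1` B i))%E.
have finC : C \is a fin_num.
  rewrite fin_numM// big_seq prode_fin_num// => j jS.
    by rewrite finf// inE jS orbT.
  by apply: fin_num_measure; exact: measurable_funPTI.
transitivity (\int[P]_w (Z w * f i (X i w))%:E)%E.
  by apply: eq_integral => w _; rewrite big_cons /Z -mulrA mulrC.
rewrite (@integral_mul_of_law _ _ (fine C))//.
- by rewrite fineK// big_cons muleC muleA.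
- apply: measurable_funM; apply: measurable_prod => j _.
    exact: measurableT_comp.
  exact: measurable_indic_comp.
- by move=> w; rewrite mulr_ge0// prodr_ge0.
- move=> B0 mB0; rewrite fineK//.
  (* Since [i] is not in [S2], the factors already indexed by [S2] keep their sets. *)
  pose B' j := if j == i then B0 else B j.
  have B'i : B' i = B0 by rewrite /B' eqxx.
  have eB' j : j \in S2 -> B' j = B j.
    rewrite /B'; case: eqP => // -> iS2.
    by move: iS; rewrite mem_cat iS2 orbT.
  have := ih (i :: S2) B'; rewrite !big_cons B'i.
  rewrite (_ : \prod_(j <- S2) P (X j @^-1` B' j) =
    \prod_(j <- S2) P (X j @^-1` B j))%E; last first.
    by apply: eq_big_seq => j /eB' ->.
  rewrite /C -muleA (muleC (\prod_(j <- S2) _)%E) => <-.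
  - apply: eq_integral => w _; rewrite big_cons B'i mulrAC -mulrA.
    by congr (_ * (_ * _))%:E; apply: eq_big_seq => j /eB' ->.
  - by move=> j jS; rewrite finf// inE jS orbT.
  - by rewrite -cat1s uniq_catCA/= iS.
  - by rewrite all_cat/= i1n -all_cat.
  - by move=> j; rewrite /B'; case: ifP.
Qed.

Lemma mgf_dot_subgaussian n (X : nat -> {RV P >-> R}) (sigma : R) c :
  mutually_independent P n X ->
  (forall t, (1 <= t <= n)%N -> forall s : R,
    (\int[P]_w (expR (s * X t w))%:E <= (expR (sigma ^+ 2 * s ^+ 2 / 2))%:E)%E) ->
  (\int[P]_w (expR (dot n c (X ^~ w)))%:E <=
    (expR (sigma ^+ 2 * dot n c c / 2))%:E)%E.
Proof.
move=> indep subg.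
have rangeP t : (t \in index_iota 1 n.+1) = (1 <= t <= n)%N.
  by rewrite mem_index_iota ltnS.
have := @integral_prod_independent n X (fun t x => expR (c t * x))
  (index_iota 1 n.+1) [::] (fun=> setT) indep.
rewrite cats0 big_nil mule1 => H.
have -> : (\int[P]_w (expR (dot n c (X ^~ w)))%:E =
  \prod_(t <- index_iota 1 n.+1) \int[P]_w (expR (c t * X t w))%:E)%E.
  rewrite -H => {H}.
  - by apply: eq_integral => w _; rewrite big_nil mulr1 -expR_sum.
  - move=> t; apply: measurableT_comp => //; exact: measurable_funM.
  - by move=> t x; exact: expR_ge0.
  - move=> t; rewrite rangeP => tn; rewrite ge0_fin_numE.
      by apply: le_lt_trans (subg t tn (c t)) _; rewrite ltry.
    by apply: integral_ge0 => w _; rewrite lee_fin expR_ge0.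
  - exact: iota_uniq.
  - by apply/allP => t; rewrite rangeP.
  - by [].
have -> : expR (sigma ^+ 2 * dot n c c / 2) =
    \prod_(t <- index_iota 1 n.+1) expR (sigma ^+ 2 * c t ^+ 2 / 2).
  by rewrite -expR_sum -mulr_suml -mulr_sumr.
rewrite -prodEFin big_seq [leRHS]big_seq.
(* Products of inequalities in the extended reals need nonnegative factors, so nonnegativity is
   carried along. *)
apply: proj2 (_ : 0 <= _ /\ _)%E.
apply: (big_ind2 (fun x y : \bar R => (0 <= x /\ x <= y)%E)) => //.
  move=> x1 x2 y1 y2 [x10 x12] [y10 y12]; rewrite mule_ge0//.
  by split => //; exact: lee_pmul.
move=> t; rewrite rangeP => tn; split; last exact: subg.
by apply: integral_ge0 => w _; rewrite lee_fin expR_ge0.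
Qed.
End Independence.

(** * Two Gaussian integrals *)

Section GaussianMixture.
Variable R : realType.
Local Notation leb := (@lebesgue_measure R).

(** Completing the square turns the integrand into a constant times the normal density with mean
    [a]. *)
Lemma integral_gaussian_mgf (a : R) :
  (\int[leb]_g (normal_pdf 0 1 g * expR (a * g))%:E = (expR (a ^+ 2 / 2))%:E)%E.
Proof.
transitivity (\int[leb]_g ((expR (a ^+ 2 / 2))%:E * (normal_pdf a 1 g)%:E))%E.
  apply: eq_integral => g _; rewrite -EFinM; congr EFin.
  rewrite !normal_pdfE ?oner_neq0// /normal_fun.
  rewrite mulrCA -mulrA; congr (_ * _); rewrite -!expRD; congr expR.
  by field.
rewrite ge0_integralZl//=.
- by rewrite integral_normal_pdf mule1.
- by apply/measurable_EFinP; exact: measurable_normal_pdf.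
- by move=> g _; rewrite lee_fin normal_pdf_ge0.
Qed.

(** With [r ^+ 2 = 1 - 2 * a], the integrand is [r^-1] times the centred normal density of standard
    deviation [r^-1]. *)
Lemma integral_gaussian_sqr (a : R) : 2 * a < 1 ->
  (\int[leb]_g (normal_pdf 0 1 g * expR (a * g ^+ 2))%:E =
   ((Num.sqrt (1 - 2 * a))^-1)%:E)%E.
Proof.
move=> a1; set r := Num.sqrt (1 - 2 * a).
have r0 : 0 < r by rewrite sqrtr_gt0 subr_gt0.
have rN0 : r^-1 != 0 by rewrite invr_eq0 gt_eqF.
have r2 : r ^+ 2 = 1 - 2 * a by rewrite sqr_sqrtr// subr_ge0 ltW.
transitivity (\int[leb]_g ((r^-1)%:E * (normal_pdf 0 r^-1 g)%:E))%E.
  apply: eq_integral => g _; rewrite -EFinM; congr EFin.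
  rewrite !normal_pdfE ?oner_neq0// /normal_fun /normal_peak.
  rewrite expr1n mul1r -mulrnAr sqrtrM ?sqr_ge0// sqrtr_sqr ger0_norm ?invr_ge0 ?ltW//.
  rewrite -!mulrA; rewrite [in RHS]invfM invrK.
  have -> : r^-1 * (r * (Num.sqrt (pi *+ 2))^-1 *
     expR (- (g - 0) ^+ 2 * (r^-1 ^+ 2 *+ 2)^-1)) = (Num.sqrt (pi *+ 2))^-1 *
     expR (- (g - 0) ^+ 2 * (r^-1 ^+ 2 *+ 2)^-1) by rewrite -mulrA mulKf// gt_eqF.
  rewrite -expRD; congr (_ * expR _).
  have -> : (r^-1 ^+ 2 *+ 2)^-1 = (1 - 2 * a) / 2.
    by rewrite -r2 -mulr_natr; field; rewrite gt_eqF.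
  by field.
rewrite ge0_integralZl//=.
- by rewrite integral_normal_pdf mule1.
- by apply/measurable_EFinP; exact: measurable_normal_pdf.
- by move=> g _; rewrite lee_fin normal_pdf_ge0.
- by rewrite lee_fin invr_ge0 ltW.
Qed.

End GaussianMixture.

(** * Exponential moments of the squared norm of a projection *)

Section QuadraticMGF.
Context d (T : measurableType d) (R : realType) (P : probability T R).
Variables (n : nat) (X : T -> nat -> R) (sigma : R).
Hypothesis mX : forall t, measurable_fun setT (X^~ t).
Hypothesis subgX : forall c : nat -> R,
  (\int[P]_w (expR (dot n c (X w)))%:E <= (expR (sigma ^+ 2 * dot n c c / 2))%:E)%E.

Lemma measurable_dot c : measurable_fun setT (fun w => dot n c (X w)).
Proof.
by apply: measurable_sum => t; apply: measurable_funM.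
Qed.

Lemma measurable_sum_sqr_dot (es : seq (nat -> R)) :
  measurable_fun setT (fun w => \sum_(e <- es) dot n e (X w) ^+ 2).
Proof.
by apply: measurable_sum => e; apply: measurable_funX; exact: measurable_dot.
Qed.

(* [exp (kap z^2)] is the Gaussian average of [exp (sqrt (2 kap) g z)]; averaging
   over one independent Gaussian per basis vector linearises the quadratic form. *)
Lemma mgf_sum_sqr_dot kap (es : seq (nat -> R)) c : 0 <= kap ->
  2 * kap * sigma ^+ 2 < 1 -> orthonormal_seq n es -> orthogonal_to n c es ->
  (\int[P]_w (expR (dot n c (X w) + kap * \sum_(e <- es) dot n e (X w) ^+ 2))%:E <=
   (expR (sigma ^+ 2 * dot n c c / 2) *
    (Num.sqrt (1 - 2 * kap * sigma ^+ 2))^-1 ^+ size es)%:E)%E.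
Proof.
move=> kap0 kap1; elim: es c => [|e es ih] c.
  move=> _ _; rewrite expr0 mulr1; apply: le_trans (subgX c).
  by rewrite le_eqVlt; apply/orP; left; apply/eqP/eq_integral => w _;
    rewrite big_nil mulr0 addr0.
move=> /= [e1 ees oes] ces.
set r := (Num.sqrt _)^-1.
pose s := Num.sqrt (2 * kap).
have s2 : s ^+ 2 = 2 * kap by rewrite sqr_sqrtr// mulr_ge0.
(* The Gaussian variable [g] tilts the linear form along [e]; this is why the induction is over all
   [c] orthogonal to [es]. *)
pose cg g := fun t => c t + s * g * e t.
pose S w := \sum_(e' <- es) dot n e' (X w) ^+ 2.
pose F (wg : T * R) : \bar R := (normal_pdf 0 1 wg.2 *
  expR (dot n c (X wg.1) + s * wg.2 * dot n e (X wg.1) + kap * S wg.1))%:E.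
have mF : measurable_fun setT F.
  apply/measurable_EFinP; apply: measurable_funM.
    exact: (measurableT_comp (measurable_normal_pdf _ _)).
  apply: measurableT_comp => //; apply: measurable_funD; first apply: measurable_funD.
  - exact: (measurableT_comp (measurable_dot c)).
  - apply: measurable_funM; last exact: (measurableT_comp (measurable_dot e)).
    exact: measurable_funM.
  - apply: measurable_funM => //.
    exact: (measurableT_comp (measurable_sum_sqr_dot es)).
have F0 wg : (0 <= F wg)%E.
  by rewrite lee_fin mulr_ge0 ?expR_ge0 ?normal_pdf_ge0.
have -> : (\int[P]_w (expR (dot n c (X w) +
      kap * \sum_(e' <- e :: es) dot n e' (X w) ^+ 2))%:E =
    \int[P]_w \int[lebesgue_measure]_g F (w, g))%E.
  apply: eq_integral => w _; rewrite big_cons -/(S w).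
  transitivity ((expR (dot n c (X w) + kap * S w))%:E *
      \int[lebesgue_measure]_g
        (normal_pdf 0 1 g * expR (s * dot n e (X w) * g))%:E)%E.
    rewrite integral_gaussian_mgf -EFinM -expRD exprMn s2; congr (expR _)%:E.
    by field.
  rewrite -ge0_integralZl//=.
  - apply: eq_integral => g _; rewrite /F/= -EFinM mulrCA -expRD.
    by congr (_ * expR _)%:E; ring.
  - apply/measurable_EFinP; apply: measurable_funM.
      exact: measurable_normal_pdf.
    by apply: measurableT_comp => //; exact: measurable_funM.
  - by move=> g _; rewrite lee_fin mulr_ge0 ?expR_ge0 ?normal_pdf_ge0.
rewrite (@fubini_tonelli _ _ _ _ R P lebesgue_measure F mF F0).
apply: (@le_trans _ _ (\int[lebesgue_measure]_g
   ((expR (sigma ^+ 2 * dot n c c / 2) * r ^+ size es)%:E *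
     (normal_pdf 0 1 g * expR (kap * sigma ^+ 2 * g ^+ 2))%:E))%E).
  apply: ge0_le_integral => //.
  - by move=> g _; apply: integral_ge0.
  - exact: (measurable_fun_fubini_tonelli_G _ mF F0).
  - apply: measurable_funeM; apply/measurable_EFinP; apply: measurable_funM.
      exact: measurable_normal_pdf.
    apply: measurableT_comp => //.
    by apply: measurable_funM => //; exact: measurable_funX.
  - move=> g _.
    have -> : (\int[P]_w F (w, g) = (normal_pdf 0 1 g)%:E * \int[P]_w
        (expR (dot n (cg g) (X w) + kap * S w))%:E)%E.
      rewrite -ge0_integralZl//=.
      + apply: eq_integral => w _; rewrite /F -EFinM/= /cg dotDl dotZl.
        by [].
      + apply/measurable_EFinP; apply: measurableT_comp => //.
        apply: measurable_funD; first exact: measurable_dot.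
        by apply: measurable_funM => //; exact: measurable_sum_sqr_dot.
      + by rewrite lee_fin normal_pdf_ge0.
    have cges : orthogonal_to n (cg g) es.
      move=> e' e'es; rewrite /cg dotDl dotZl ees// mulr0 addr0 ces//.
      by rewrite inE e'es orbT.
    have := ih (cg g) oes cges; rewrite -/r => /(lee_wpmul2l _).
    move=> /(_ (normal_pdf 0 1 g)%:E); rewrite lee_fin normal_pdf_ge0 => /(_ isT).
    move=> /le_trans; apply; rewrite -!EFinM lee_fin.
    (* Pythagoras: [e] is a unit vector orthogonal to [c]. The new term yields
       [expR (kap * sigma ^+ 2 * g ^+ 2)], whose Gaussian average is the extra factor [r]. *)
    have -> : dot n (cg g) (cg g) = dot n c c + 2 * kap * g ^+ 2.
      have ce : dot n c e = 0 by rewrite ces// inE eqxx.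
      rewrite /cg dotDl !dotDr !dotZl !dotZr e1 (dotC n e c) ce -s2.
      by ring.
    rewrite mulrDr mulrDl expRD le_eqVlt; apply/orP; left; apply/eqP.
    rewrite (_ : sigma ^+ 2 * (2 * kap * g ^+ 2) / 2 = kap * sigma ^+ 2 * g ^+ 2);
      last by field.
    by ring.
rewrite ge0_integralZl//=.
- rewrite integral_gaussian_sqr; last by rewrite mulrA.
  by rewrite (mulrA 2 kap) -/r -EFinM lee_fin [r ^+ _.+1]exprSr mulrA.
- apply/measurable_EFinP; apply: measurable_funM.
    exact: measurable_normal_pdf.
  by apply: measurableT_comp => //; apply: measurable_funM => //; exact: measurable_funX.
- by move=> g _; rewrite lee_fin mulr_ge0 ?expR_ge0 ?normal_pdf_ge0.
- by rewrite lee_fin mulr_ge0 ?expR_ge0// exprn_ge0// invr_ge0.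
Qed.

End QuadraticMGF.

(** * Chernoff bound, union bound and measurability *)

Section ProbabilityBounds.
Context d (T : measurableType d) (R : realType) (P : probability T R).

Lemma measurable_superlevel (Y : T -> R) (a : R) : measurable_fun setT Y ->
  measurable [set w | a <= Y w].
Proof.
move=> mY; rewrite (_ : [set w | _] = setT `&` Y @^-1` `[a, +oo[); first exact: mY.
by rewrite setTI; apply/seteqP; split => w /=; rewrite in_itv/= andbT.
Qed.

Lemma chernoff_integral (Y : T -> R) (a : R) : measurable_fun setT Y ->
  (P [set w | (a <= Y w)%R] <= (expR (- a))%:E * \int[P]_w (expR (Y w))%:E)%E.
Proof.
move=> mY; set A := [set w | _].
have mA : measurable A by exact: measurable_superlevel.
have mexp : measurable_fun setT (fun w => (expR (Y w))%:E).
  by apply/measurable_EFinP; exact: measurableT_comp.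
rewrite -[in leLHS](setIT A) -(integral_indic _ measurableT)// -ge0_integralZl//=.
- apply: ge0_le_integral => //.
  + by apply/measurable_EFinP; exact: measurable_indic.
  + exact: measurable_funeM.
  + move=> w _; rewrite -EFinM lee_fin -expRD indicE.
    case: (boolP (w \in A)) => [|_]; last exact: expR_ge0.
    by rewrite inE/= => aY; rewrite -[1%:R]expR0 ler_expR addrC subr_ge0.
Qed.

Lemma union_bound (I : eqType) (s : seq I) (A : I -> set T) (E : set T) :
  measurable E -> (forall i, measurable (A i)) ->
  (forall w, E w -> exists2 i, i \in s & A i w) ->
  (P E <= \sum_(i <- s) P (A i))%E.
Proof.
move=> + mA; elim: s E => [|i s ih] E mE EA.
  rewrite big_nil (_ : E = set0) ?measure0//.
  by apply/seteqP; split => // w /EA[].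
rewrite big_cons; apply: (@le_trans _ _ (P (A i `|` (E `\` A i)))).
  apply: le_measure; rewrite ?inE//.
    by apply: measurableU => //; exact: measurableD.
  by move=> w Ew; case: (pselect (A i w)); [left|right].
apply: le_trans (measureU2 _ _ _) _ => //; first exact: measurableD.
rewrite leeD2l// ih//; first exact: measurableD.
move=> w [/EA[j]]; rewrite inE => /orP[/eqP ->//|js Aj _].
by exists j.
Qed.

(* [N] is the union of the boxes with rational centre that it contains. *)
Lemma measurable_locally_determined n (X : nat -> T -> R) (N : set T) :
  (forall t, measurable_fun setT (X t)) ->
  (forall w, N w -> exists2 e, 0 < e & forall w',
    (forall t, (1 <= t <= n)%N -> `|X t w' - X t w| < e) -> N w') ->
  measurable N.
Proof.
move=> mX locN.
pose box (qk : {ffun 'I_n.+1 -> rat} * nat) := \bigcap_(t : 'I_n.+1)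
  [set w | `|X t w - ratr (qk.1 t)| < qk.2.+1%:R^-1].
have mbox qk : measurable (box qk).
  apply: fin_bigcap_measurable => //= t _.
  pose g w := `|X t w - ratr (qk.1 t)|.
  have mg : measurable_fun setT g.
    by apply: measurableT_comp => //; exact: measurable_funB.
  rewrite -[X in measurable X]setTI.
  rewrite (_ : [set w | _] = g @^-1` `]-oo, qk.2.+1%:R^-1[); first exact: mg.
  by apply/seteqP; split => w /=; rewrite in_itv/=.
pose F qk := if pselect (box qk `<=` N) then box qk else set0.
rewrite (_ : N = \bigcup_qk F qk).
  apply: countable_bigcupT_measurable => [|qk]; first exact: countableP.
  by rewrite /F; case: pselect => _ /=.
apply/seteqP; split => [w Nw|w [qk _]]; last first.
  by rewrite /F; case: pselect => // bN; exact: bN.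
have [e e0 He] := locN _ Nw.
(* Both the given point and any other point of the box are within [k.+1%:R^-1] of the rational
   centre, so they differ by less than [e] in each coordinate. *)
have [k ke] : exists k : nat, k.+1%:R^-1 < e / 2.
  have e20 : 0 < e / 2 by rewrite divr_gt0.
  by have [k _ /(_ k (leqnn k))] := near_infty_natSinv_lt (PosNum e20); exists k.
have /choice[q qP] (t : 'I_n.+1) : exists q : rat, `|X t w - ratr q| < k.+1%:R^-1.
  have [|q] := @rat_in_itvoo R (X t w - k.+1%:R^-1) (X t w + k.+1%:R^-1).
    by rewrite ltrD2l gtrN.
  by rewrite in_itv/= => qX; exists q; rewrite distrC ltr_distl.
exists ([ffun t => q t], k) => //; rewrite /F; case: pselect => [bN|nbN] /=.
  by move=> t _ /=; rewrite ffunE.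
case: nbN => w' bw'; apply: He => t /andP[t1 tn].
have tn1 : (t < n.+1)%N by [].
have := bw' (Ordinal tn1) Logic.I; rewrite /= ffunE => H1.
have /= H2 := qP (Ordinal tn1).
rewrite -(subrK (ratr (q (Ordinal tn1))) (X t w')) -addrA.
apply: le_lt_trans (ler_normD _ _) _; rewrite distrC in H2.
by rewrite (splitr e) ltrD// (lt_trans _ ke).
Qed.

End ProbabilityBounds.

(** Squaring [1 + y / 2 <= expR (y / 2)] gives [expR y >= (1 + y / 2) ^+ 2], which exceeds [2 * y]
    by [(1 - y / 2) ^+ 2]. *)
Lemma expR_ge_double (R : realType) (y : R) : 0 <= y -> 2 * y <= expR y.
Proof.
move=> y0; rewrite (splitr y) expRD -splitr.
have h := expR_ge1Dx (y / 2); have y2 : 0 <= 1 + y / 2 by lra.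
apply: le_trans (ler_pM y2 y2 h h).
by have := sqr_ge0 (1 - y / 2); lra.
Qed.

(** * Tail bound for one projection *)

Section SubspaceTail.
Context d (T : measurableType d) (R : realType) (P : probability T R).
Variables (n : nat) (X : T -> nat -> R) (sigma : R).
Hypothesis mX : forall t, measurable_fun setT (X^~ t).
Hypothesis sigma_gt0 : 0 < sigma.
Hypothesis subgX : forall c : nat -> R,
  (\int[P]_w (expR (dot n c (X w)))%:E <= (expR (sigma ^+ 2 * dot n c c / 2))%:E)%E.

(* Chernoff's bound with [kap] chosen so that [1 - 2 kap sigma^2 = A / 2]. *)
Lemma subspace_tail (A x : R) (K : nat) (es : seq (nat -> R)) : 0 < A < 1 ->
  8 * K%:R <= A ^+ 2 * x ^+ 2 -> (size es <= 2 * K)%N -> orthonormal_seq n es ->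
  (P [set w | ((sigma * x * (1 - A / 4)) ^+ 2 <= \sum_(e <- es) dot n e (X w) ^+ 2)%R]
   <= (expR (- ((1 - A) ^+ 2 * x ^+ 2 / 2)))%:E)%E.
Proof.
move=> /andP[A0 A1] KA ses oes.
have sN0 : sigma != 0 by rewrite gt_eqF.
pose kap := (1 - A / 2) / (2 * sigma ^+ 2).
have kap0 : 0 < kap by rewrite divr_gt0 ?mulr_gt0 ?exprn_gt0//; lra.
have kapE : 2 * kap * sigma ^+ 2 = 1 - A / 2 by rewrite /kap; field.
pose Y w := kap * \sum_(e <- es) dot n e (X w) ^+ 2.
pose a := kap * (sigma * x * (1 - A / 4)) ^+ 2.
have -> : [set w | (sigma * x * (1 - A / 4)) ^+ 2 <=
    \sum_(e <- es) dot n e (X w) ^+ 2] = [set w | a <= Y w].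
  by apply/seteqP; split => w /=; rewrite /a /Y ler_pM2l.
apply: le_trans (chernoff_integral _ _ _) _.
  by apply: measurable_funM => //; exact: measurable_sum_sqr_dot.
have dot0 (v : nat -> R) : dot n (fun=> 0) v = 0.
  by rewrite /dot big1// => t _; rewrite mul0r.
have := @mgf_sum_sqr_dot _ _ _ P n X sigma mX subgX kap es (fun=> 0) (ltW kap0) _ oes.
rewrite kapE dot0 mulr0 mul0r expR0 mul1r.
rewrite (_ : 1 - (1 - A / 2) = A / 2); last by lra.
under eq_integral do rewrite dot0 add0r.
rewrite ltrBlDr ltrDl divr_gt0// => /(_ isT (fun e _ => dot0 e)) H.
apply: (@le_trans _ _ ((expR (- a))%:E * ((Num.sqrt (A / 2))^-1 ^+ size es)%:E)%E).
  by apply: lee_wpmul2l => //; rewrite lee_fin expR_ge0.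
rewrite -EFinM lee_fin.
have r1 : 1 <= (Num.sqrt (A / 2))^-1.
  rewrite invr_ge1 ?unitfE ?gt_eqF ?sqrtr_gt0 ?divr_gt0//.
  by rewrite -[leRHS]sqrtr1 ler_sqrt//; lra.
(* At most [2 * K] factors give [(2 / A) ^+ K], and [2 / A <= expR (A^-1)] by [expR_ge_double]. *)
have r2K : (Num.sqrt (A / 2))^-1 ^+ size es <= expR (K%:R / A).
  apply: (@le_trans _ _ ((Num.sqrt (A / 2))^-1 ^+ (2 * K))).
    exact: ler_weXn2l.
  rewrite exprM exprVn sqr_sqrtr ?divr_ge0 ?(ltW A0)//.
  rewrite expRM_natl lerXn2r ?nnegrE ?invr_ge0 ?divr_ge0 ?(ltW A0) ?expR_ge0//.
  by rewrite invf_div; apply: expR_ge_double; rewrite invr_ge0 ltW.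
apply: (@le_trans _ _ (expR (- a) * expR (K%:R / A))).
  by rewrite ler_wpM2l ?expR_ge0.
rewrite -expRD ler_expR.
have KA' : K%:R / A <= A * x ^+ 2 / 8.
  by rewrite ler_pdivrMr//; lra.
have -> : a = (1 - A / 2) / 2 * (1 - A / 4) ^+ 2 * x ^+ 2.
  by rewrite /a /kap; field.
have A2 : A ^+ 2 <= 1 by rewrite expr_le1// ltW.
(* This is exactly [a - A * x ^+ 2 / 8 - (1 - A) ^+ 2 * x ^+ 2 / 2]. The bracket decreases in [A]
   and equals 1/32 at [A = 1]. *)
have : 0 <= x ^+ 2 * (A / 2 * (3 / 4 - 11 * A / 16 - A ^+ 2 / 32)).
  by apply: mulr_ge0; [exact: sqr_ge0|apply: mulr_ge0; lra].
lra.
Qed.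

End SubspaceTail.

(** * Enumerating the kink sets and final assembly *)

(** Maps are used in place of sets because their number is just [n ^ m]; a smaller set is padded
    with the default index 0. *)
Lemma set_covered_by_ffun n m (S : {set 'I_n}) : (0 < n)%N -> (#|S| <= m)%N ->
  exists f : {ffun 'I_m -> 'I_n}, forall s, s \in S -> exists i, f i = s.
Proof.
move=> n0 Sm; exists [ffun i : 'I_m => nth (Ordinal n0) (enum S) i] => s sS.
have si : (index s (enum S) < #|S|)%N by rewrite cardE index_mem mem_enum.
by exists (Ordinal (leq_trans si Sm)); rewrite ffunE/= nth_index ?mem_enum.
Qed.

(** By [truncated_power_rep], a vector is a combination of the constant, the identity and the hinges
    at its kinks. *)
Lemma fixed_by_of_kinks (R : realType) n (es : seq (nat -> R)) (mu : nat -> R) :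
  fixed_by n es (fun=> 1) -> fixed_by n es (fun t => t%:R) ->
  (forall s, s \in kinks n mu -> fixed_by n es (trunc_line R s)) ->
  fixed_by n es mu.
Proof.
move=> f1 fid fk.
apply: (@eq_fixed_by _ _ _ (fun t => (mu 1 - (mu 2 - mu 1)) * 1 + (mu 2 - mu 1) * t%:R
    + \sum_(s in kinks n mu) diff2 mu s.+1 * trunc_line R s t)).
  by move=> t tn /=; rewrite [RHS](truncated_power_rep _ tn); congr (_ + _); ring.
apply: fixed_byD; first by apply: fixed_byD; exact: fixed_byZ.
by apply: fixed_by_sum => s /fk; exact: fixed_byZ.
Qed.

Local Open Scope ereal_scope.
Local Open Scope ring_scope.

Theorem theorem1 (d : measure_display) (T : measurableType d) (R : realType)
  (P : probability T R) (n : nat) (hn : (2 <= n)%N)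
  (mu0 : nat -> R)
  (* joint piecewise linear trend with kink points tk and lines (a j, b j) *)
  (J : nat) (tk : nat -> nat) (a b : nat -> R)
  (htk0 : tk 0%N = 1%N) (htkJ : tk J.+1 = n.+1)
  (htk_incr : forall j, (j <= J)%N -> (tk j < tk j.+1)%N)
  (hpiece : forall j t, (1 <= j <= J.+1)%N -> (tk j.-1 <= t <= (tk j).-1)%N ->
     mu0 t = a j + b j * t%:R)
  (hjoint : forall j, (1 <= j <= J)%N ->
     a j + b j * (tk j)%:R = a j.+1 + b j.+1 * (tk j)%:R)
  (eps : nat -> {RV P >-> R}) (sigma : R) (hsigma : 0 < sigma)
  (* (A1) *)
  (hindep : mutually_independent P n eps)
  (hident : identically_distributed P n eps)
  (hmean : forall t, (1 <= t <= n)%N -> 'E_P[eps t] = 0%E)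
  (hvar : forall t, (1 <= t <= n)%N ->
     P.-integrable setT (EFin \o (fun w => eps t w ^+ 2)) /\
     'V_P[eps t] = (sigma ^+ 2)%:E)
  (hsubg : forall t, (1 <= t <= n)%N -> forall s : R,
     ('E_P[fun w => expR (s * eps t w)] <= (expR (sigma ^+ 2 * s ^+ 2 / 2))%:E)%E)
  (* (A2) *)
  (Jmax : nat) (hA2 : (num_pieces n mu0 <= Jmax)%N)
  (* the l1 trend filter estimator, for every lambda > 0 and every outcome *)
  (muhat : R -> T -> nat -> R)
  (hmuhat : forall lam : R, 0 < lam -> forall w,
     tf_argmin n (fun t => mu0 t + eps t w) lam (muhat lam w))
  (lam0 : R) (hlam0 : 0 < lam0)
  (hlam0_pieces : forall lam, lam0 < lam -> forall w,
     (num_pieces n (muhat lam w) <= Jmax)%N)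
  (A B : R) (hA : 0 < A < 1) (hB : 2 / (1 - A) ^+ 2 < B)
  (lamn : R)
  (hlamn : lamn = 16^-1 * sigma * A * Num.sqrt (B * Jmax%:R * ln n%:R)
                    / Num.sqrt n%:R
                  - Num.sqrt (32^-1) * sigma * Num.sqrt Jmax%:R / Num.sqrt n%:R)
  (hlamn0 : lam0 < lamn) :
  (P [set w | (sigma * Num.sqrt (B * Jmax%:R * ln n%:R / n%:R)
               <= (Num.sqrt n%:R)^-1 * dist2 n (muhat lamn w) mu0)%R]
   <= (Jmax%:R * n%:R `^ ((1 - B * (1 - A) ^+ 2 / 2) * Jmax%:R))%:E)%E.
Proof.
have n0 : (0 < n)%N by exact: ltnW.
have n1 : 1 < n%:R :> R by rewrite ltr1n.
have snp : 0 < Num.sqrt n%:R :> R by rewrite sqrtr_gt0 ltr0n.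
have /andP[A0 A1] := hA.
have lam_gt0 : 0 < lamn by exact: lt_trans hlam0 hlamn0.
set x := Num.sqrt (B * Jmax%:R * ln n%:R) in hlamn *.
have B0 : 0 < B.
  by apply: lt_trans hB; rewrite divr_gt0// exprn_gt0// subr_gt0.
have L0 : 0 < ln n%:R :> R by rewrite ln_gt0.
have x2 : x ^+ 2 = B * Jmax%:R * ln n%:R.
  by rewrite sqr_sqrtr// mulr_ge0 ?mulr_ge0 ?(ltW B0) ?(ltW L0) ?ler0n.
have x0 : 0 <= x by exact: sqrtr_ge0.
(* This is the coefficient of the norm in the basic inequality. Its leading part [sigma * A * x / 4]
   causes the loss factor [1 - A / 4]; the subtracted part only helps. *)
have lamE : 4 * lamn * Num.sqrt n%:R =
    sigma * (A * x / 4 - 4 * Num.sqrt 32^-1 * Num.sqrt Jmax%:R).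
  by rewrite hlamn; field; rewrite gt_eqF.
have Ax : 4 * (4 * Num.sqrt 32^-1 * Num.sqrt Jmax%:R) < A * x.
  have : 0 < 4 * lamn * Num.sqrt n%:R by rewrite !mulr_gt0.
  by rewrite lamE pmulr_rgt0//; lra.
have q0 : 0 <= 4 * Num.sqrt 32^-1 * Num.sqrt Jmax%:R :> R.
  by rewrite !mulr_ge0 ?sqrtr_ge0.
(* Squaring [Ax], which expresses [0 < lamn], produces the constant [16 ^ 2 / 32 = 8]. *)
have Ax2 : 8 * Jmax%:R <= A ^+ 2 * x ^+ 2.
  have : (4 * (4 * Num.sqrt 32^-1 * Num.sqrt Jmax%:R)) ^+ 2 <= (A * x) ^+ 2.
    by rewrite ler_sqr ?nnegrE ?mulr_ge0 ?(ltW A0)// ltW.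
  have q2 : Num.sqrt 32^-1 ^+ 2 = 32^-1 :> R by rewrite sqr_sqrtr// invr_ge0 ler0n.
  have J2 : Num.sqrt Jmax%:R ^+ 2 = Jmax%:R :> R by rewrite sqr_sqrtr ?ler0n.
  rewrite !exprMn q2 J2 => H; apply: le_trans H.
  by rewrite le_eqVlt; apply/orP; left; apply/eqP; field.
have xp : 0 < x.
  by rewrite -(pmulr_rgt0 _ A0); apply: le_lt_trans Ax; lra.
have K0 : (0 < Jmax)%N.
  rewrite lt0n; apply/negP => /eqP K0; move: xp.
  by rewrite /x K0 mulr0 mul0r sqrtr0 ltxx.
pose X w t := eps t w.
have mX t : measurable_fun setT (X^~ t) by exact: measurable_funP.
have subgX c : (\int[P]_w (expR (dot n c (X w)))%:E <=
    (expR (sigma ^+ 2 * dot n c c / 2))%:E)%E.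
  apply: mgf_dot_subgaussian => // t tn s.
  by have := hsubg t tn s; rewrite unlock.
have kcard (mu : nat -> R) : (num_pieces n mu <= Jmax)%N -> (#|kinks n mu| <= Jmax.-1)%N.
  move=> pJ; have := leq_trans (card_kinks mu hn) pJ.
  by case: (Jmax) => //= k; rewrite ltnS.
(* Hinges at the kinks of [mu0], then at the candidate kinks [f] of the estimator. With the constant
   and the identity there are at most [2 + 2 * Jmax.-1 = 2 * Jmax] vectors. *)
pose kink_seq (f : {ffun 'I_Jmax.-1 -> 'I_n}) :=
  [seq trunc_line R s | s : 'I_n <- enum (kinks n mu0) ++
    [seq f i | i <- enum 'I_Jmax.-1]].
have [es esP] := choice (fun f => gram_schmidt n
  ((fun=> 1) :: (fun t => t%:R) :: kink_seq f)).
have ses f : (size (es f) <= 2 * Jmax)%N.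
  have [/leq_trans-> //] := esP f; rewrite /= size_map size_cat size_map -!cardE card_ord.
  have -> : (2 * Jmax)%N = (Jmax.-1 + Jmax.-1).+2 by move: K0; clear; lia.
  by rewrite !ltnS leq_add2r kcard.
pose dl w t := muhat lamn w t - mu0 t.
have argmin w := hmuhat _ lam_gt0 w.
set E := [set w | _].
have EE : E = [set w | sigma * x <= enorm n (dl w)].
  have sE : Num.sqrt (B * Jmax%:R * ln n%:R / n%:R) = x / Num.sqrt n%:R.
    by rewrite sqrtrM ?sqrtrV ?ler0n// -x2 sqr_ge0.
  by apply/seteqP; split => w; rewrite /E/= dist2E -/(dl w) sE mulrA;
    rewrite (mulrC _^-1) ler_pM2r ?invr_gt0.
(* The estimator is a 1-Lipschitz function of the observations. *)
have mE : measurable E.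
  rewrite EE -[X in measurable X]setCK; apply: measurableC.
  apply: (@measurable_locally_determined _ _ _ n (fun t => eps t)) => // w /= /negP.
  rewrite -ltNge => dlt.
  (* A perturbation below [e] in each coordinate moves the estimator by at most half the gap to the
     threshold, so the complement of [E] is locally determined by the noise. *)
  pose e := (sigma * x - enorm n (dl w)) / (2 * Num.sqrt n%:R).
  have e0 : 0 < e by rewrite divr_gt0 ?mulr_gt0 ?subr_gt0.
  exists e => // w' ww'; apply/negP; rewrite -ltNge.
  have H1 := tf_argmin_lipschitz (ltW lam_gt0) (argmin w) (argmin w').
  have H2 : enorm n (fun t => (mu0 t + eps t w') - (mu0 t + eps t w)) <=
      Num.sqrt n%:R * e.
    apply: enorm_le_sup => [|t tn]; first exact: ltW.
    by rewrite opprD addrACA subrr add0r ltW// ww'.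
  have H3 := enormD n (dl w) (fun t => muhat lamn w' t - muhat lamn w t).
  have H4 : enorm n (dl w') =
    enorm n (fun t => dl w t + (muhat lamn w' t - muhat lamn w t)).
    by congr Num.sqrt; apply: eq_dot => t _; rewrite /dl; ring.
  have e2 : Num.sqrt n%:R * e = (sigma * x - enorm n (dl w)) / 2.
    by rewrite /e; field; rewrite gt_eqF.
  by rewrite H4; move: H1 H2 H3; rewrite e2; lra.
pose Ev f := [set w | (sigma * x * (1 - A / 4)) ^+ 2 <=
  \sum_(e <- es f) dot n e (X w) ^+ 2].
have mEv f : measurable (Ev f).
  by apply: measurable_superlevel; exact: measurable_sum_sqr_dot.
(* The map [f] depends on the outcome [w], but it ranges over a finite set fixed in advance. *)
have cover w : E w -> exists2 f, f \in enum {ffun 'I_Jmax.-1 -> 'I_n} & Ev f w.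
  rewrite EE /= => Ew.
  have [f fP] := set_covered_by_ffun n0 (kcard _ (hlam0_pieces _ hlamn0 w)).
  exists f; first by rewrite mem_enum.
  have [_ oes fes] := esP f.
  have fixed1 : fixed_by n (es f) (fun=> 1) by apply: fes; rewrite inE eqxx.
  have fixedid : fixed_by n (es f) (fun t => t%:R).
    by apply: fes; rewrite !inE eqxx orbT.
  have fixedk s : s \in enum (kinks n mu0) ++ [seq f i | i <- enum 'I_Jmax.-1] ->
      fixed_by n (es f) (trunc_line R s).
    by move=> sk; apply: fes; rewrite !inE [X in _ || (_ || X)]map_f ?orbT.
  have fixdl : fixed_by n (es f) (dl w).
    apply: (@eq_fixed_by _ _ _ (fun t => muhat lamn w t + (-1) * mu0 t)).
      by move=> t _; rewrite mulN1r.
    apply: fixed_byD; last apply: fixed_byZ; apply: fixed_by_of_kinks => // s sk.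
      have [i <-] := fP _ sk; apply: fixedk; rewrite mem_cat; apply/orP; right.
      by apply: map_f; rewrite mem_enum.
    by apply: fixedk; rewrite mem_cat mem_enum sk.
  have dlp : 0 < enorm n (dl w) by apply: lt_le_trans Ew; rewrite mulr_gt0.
  have := tf_basic_inequality mu0 (ltW lam_gt0) (argmin w).
  rewrite -/(dl w) (@eq_dot _ _ _ (X w) (dl w) (dl w))//; last first.
    by move=> t _; rewrite addrC addKr.
  have := dot_fixed_le (X w) oes fixdl.
  set S := Num.sqrt _ => H1 H2.
  (* The basic inequality is divided by the norm of the error, which is positive on [E]. *)
  have H3 : enorm n (dl w) <= S + 4 * lamn * Num.sqrt n%:R.
    by rewrite -(ler_pM2l dlp); move: H1 H2; rewrite expr2; lra.
  have H4 : sigma * x * (1 - A / 4) <= S.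
    have := mulr_ge0 (ltW hsigma) q0.
    by move: H3; rewrite lamE; move: Ew; lra.
  rewrite /Ev/= -[leRHS]sqr_sqrtr; last by apply: sumr_ge0 => e _; exact: sqr_ge0.
  rewrite ler_sqr ?nnegrE ?sqrtr_ge0//.
  by rewrite mulr_ge0 ?mulr_ge0 ?(ltW hsigma)//; lra.
apply: le_trans (union_bound P mE mEv cover) _.
apply: (@le_trans _ _ (\sum_(f <- enum {ffun 'I_Jmax.-1 -> 'I_n})
   (expR (- ((1 - A) ^+ 2 * x ^+ 2 / 2)))%:E)%E).
  apply: lee_sum => f _.
  have [_ oes _] := esP f.
  exact: (subspace_tail mX hsigma subgX hA Ax2 (ses f) oes).
rewrite sumEFin lee_fin big_const_seq count_predT -cardE card_ffun !card_ord.
rewrite iter_addr_0 -[leLHS]mulr_natl natrX.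
rewrite /powR pnatr_eq0 gtn_eqF//.
(* As [x ^+ 2 = B * Jmax%:R * ln n%:R], the target power of [n] is [n ^ Jmax] times the
   single-projection bound. *)
rewrite (_ : (1 - B * (1 - A) ^+ 2 / 2) * Jmax%:R * ln n%:R =
  Jmax%:R * ln n%:R - (1 - A) ^+ 2 * x ^+ 2 / 2); last by rewrite x2; field.
rewrite expRD mulrA ler_wpM2r ?expR_ge0// expRM_natl lnK ?posrE ?ltr0n//.
(* The count [n ^ Jmax.-1] is bounded by [n ^ Jmax], then by [Jmax] times it since [Jmax] is
   positive. *)
apply: (@le_trans _ _ (n%:R ^+ Jmax)).
  by rewrite ler_weXn2l ?ler1n// leq_pred.
by rewrite ler_peMl ?exprn_ge0 ?ler1n.
Qed.
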